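(* Let $f(\mathbf x)=N(\mathbf x)/Q(\mathbf x)$ be an arithmetic expression whose outermost operation (the $k$-th of its $k$ operation occurrences) is a division, where $N$ and $Q$ are division-free and $Q(\mathbf x)\ne0$ for all $\mathbf x\in I_1\times\cdots\times I_m$; let $\tilde f(\mathbf x,\mathbf e,\mathbf d)$ be its floating-point model and $F(\mathbf x,\mathbf e)=\sum_{i=1}^k\left|\frac{\partial\tilde f}{\partial e_i}(\mathbf x,\mathbf 0,\mathbf 0)e_i\right|$. Let $u\in\mathbb R$ be fixed. Let $p$ be a polynomial (in the variables $x_j$ and their positive and negative parts) such that $$\sum_{i=1}^k\left|\frac{\partial\tilde f}{\partial e_i}(\mathbf x,\mathbf 0,\mathbf 0)\cdot(Q(\mathbf x))^2\cdot e_i\right|\le p(\mathbf x)\cdot\epsilon$$ for all $\mathbf x\in I_1\times\cdots\times I_m$ and all $\mathbf e$ with $|e_i|\le\epsilon$. Let $K_u(\mathbf x)=p(\mathbf x)\epsilon-(Q(\mathbf x))^2u$ and $\mu=\mathbb E[K_u(\mathbf x)]$, and suppose $\mu<0$. For an even integer $n\ge2$ define $\mathrm{flag}_u=\mathbb E[(K_u(\mathbf x)-\mu)^n]/\mu^n$. Then for every random vector $\mathbf e$ (on the same probability space as $\mathbf x$) with $|e_i|\le\epsilon$ almost surely, $$\mathbb P[F(\mathbf x,\mathbf e)\ge u]\le\mathrm{flag}_u.$$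
   Context: Arithmetic expression: built from real variables $\mathbf x=(x_1,\dots,x_m)$ and real constants using $+,-,\times,/$, operation occurrences numbered; division-free means no division by a non-constant subexpression. Floating-point model: for constants $\epsilon,\delta>0$, $\tilde f(\mathbf x,\mathbf e,\mathbf d)$, $\mathbf e=(e_1,\dots,e_k)$, $\mathbf d=(d_1,\dots,d_k)$, is obtained by recursively replacing the $i$-th operation occurrence $a\circ b$ by $(a\circ b)(1+e_i)+d_i$, so $\tilde f(\mathbf x,\mathbf 0,\mathbf 0)=f(\mathbf x)$. Inputs: $x_1,\dots,x_m$ independent real random variables, $x_j$ taking values in a bounded interval $I_j$; $\mathbb P,\mathbb E$ denote probability and expectation. Positive and negative parts: $y^+=\max\{y,0\}$, $y^-=\max\{-y,0\}$. *)

(* Defs.v *)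
From HB Require Import structures.
From mathcomp Require Import all_boot all_order all_algebra.
From mathcomp Require Import all_classical all_reals all_analysis.
From mathcomp Require mpoly.

Set Implicit Arguments.
Unset Strict Implicit.
Unset Printing Implicit Defensive.

Import Order.TTheory GRing.Theory Num.Theory.
Import numFieldNormedType.Exports.
Local Open Scope classical_set_scope.
Local Open Scope ring_scope.

Variant aop := Add | Sub | Mul | Div.

Inductive aexpr (R : Type) (m : nat) :=
  | Var of 'I_m
  | Cst of R
  | Op of aop & aexpr R m & aexpr R m.

Arguments Var {R m} _.
Arguments Cst {R m} _.
Arguments Op {R m} _ _ _.

Definition aop_eval (R : realType) (o : aop) (a b : R) : R :=
  match o with
  | Add => a + b
  | Sub => a - b
  | Mul => a * b
  | Div => a / b
  end.

Fixpoint aeval (R : realType) (m : nat) (t : aexpr R m) (x : 'rV[R]_m) : R :=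
  match t with
  | Var j => x 0 j
  | Cst c => c
  | Op o a b => aop_eval o (aeval a x) (aeval b x)
  end.

Fixpoint nops (R : Type) (m : nat) (t : aexpr R m) : nat :=
  match t with
  | Op _ a b => (nops a + nops b + 1)%N
  | _ => 0%N
  end.

(* Operation occurrences are numbered in postorder: those of the left operand, *)
(* then those of the right operand, then the operation itself, so that the     *)
(* outermost operation comes last. The error vectors are split accordingly.    *)
Fixpoint fpmodel (R : realType) (m : nat) (t : aexpr R m) (x : 'rV[R]_m) :
    'rV[R]_(nops t) -> 'rV[R]_(nops t) -> R :=
  match t return 'rV[R]_(nops t) -> 'rV[R]_(nops t) -> R with
  | Var j => fun _ _ => x 0 j
  | Cst c => fun _ _ => c
  | Op o a b => fun e d =>
      aop_eval o
        (@fpmodel R m a x (lsubmx (lsubmx e)) (lsubmx (lsubmx d)))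
        (@fpmodel R m b x (rsubmx (lsubmx e)) (rsubmx (lsubmx d)))
      * (1 + rsubmx e 0 0) + rsubmx d 0 0
  end.

Arguments fpmodel {R m} t x _ _.

Lemma fpmodel0 (R : realType) (m : nat) (t : aexpr R m) (x : 'rV[R]_m) :
  fpmodel t x 0 0 = aeval t x.
Proof.
by elim: t => //= o a <- b <-; rewrite !linear0 !mxE !addr0 mulr1.
Qed.

Fixpoint constant_expr (R : Type) (m : nat) (t : aexpr R m) : bool :=
  match t with
  | Var _ => false
  | Cst _ => true
  | Op _ a b => constant_expr a && constant_expr b
  end.

(* Every divisor is a constant subexpression. As division by 0 is total here   *)
(* (c / 0 = 0) but meaningless in an arithmetic expression, the value of that  *)
(* constant, which may be computed at any point, is required to be nonzero.    *)
Fixpoint division_free (R : realType) (m : nat) (t : aexpr R m) : bool :=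
  match t with
  | Op o a b =>
      [&& division_free a, division_free b &
          if o is Div then constant_expr b && (aeval b 0 != 0) else true]
  | _ => true
  end.

Definition dfp_de (R : realType) (m : nat) (t : aexpr R m) (x : 'rV[R]_m)
    (i : 'I_(nops t)) : R :=
  'D_(delta_mx 0 i) (fun e : 'rV[R]_(nops t) => fpmodel t x e 0) 0.

Arguments dfp_de {R m} t x i.

Definition first_order_error (R : realType) (m : nat) (t : aexpr R m)
    (x : 'rV[R]_m) (e : 'rV[R]_(nops t)) : R :=
  \sum_(i < nops t) `|dfp_de t x i * e 0 i|.

Arguments first_order_error {R m} t x e.

Definition box (R : realType) (m : nat) (I : 'I_m -> set R) : set 'rV[R]_m :=
  [set x | forall j, I j (x 0 j)].

Definition pospart (R : realType) (y : R) : R := Num.max y 0.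
Definition negpart (R : realType) (y : R) : R := Num.max (- y) 0.

(* Polynomials in the 3m quantities x_j, x_j^+, x_j^-, in this order.          *)
Definition ppoly (R : realType) (m : nat) : Type :=
  mpoly.mpoly (m + (m + m)) R.

Definition ppoly_eval (R : realType) (m : nat) (p : ppoly R m) (x : 'rV[R]_m)
    : R :=
  mpoly.meval
    (row_mx x (row_mx (map_mx (@pospart R) x) (map_mx (@negpart R) x)) 0) p.

Definition Kfun (R : realType) (m : nat) (p : ppoly R m) (Q : aexpr R m)
    (eps u : R) (x : 'rV[R]_m) : R :=
  ppoly_eval p x * eps - aeval Q x ^+ 2 * u.

Section Probability.
Variables (d : measure_display) (T : measurableType d) (R : realType).
Variable P : probability T R.

Definition mutually_independent (m : nat) (X : 'I_m -> {RV P >-> R}) : Prop :=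
  forall (J : {set 'I_m}) (B : 'I_m -> set R),
    (forall j, measurable (B j)) ->
    P (\bigcap_(j in [set` J]) (X j @^-1` B j))
    = (\prod_(j in J) P (X j @^-1` B j))%E.

Definition rvec (m : nat) (X : 'I_m -> {RV P >-> R}) (w : T) : 'rV[R]_m :=
  \row_j X j w.

Definition meanK (m : nat) (X : 'I_m -> {RV P >-> R}) (p : ppoly R m)
    (Q : aexpr R m) (eps u : R) : R :=
  fine ('E_P[fun w => Kfun p Q eps u (rvec X w)]).

Definition flag (m : nat) (X : 'I_m -> {RV P >-> R}) (p : ppoly R m)
    (Q : aexpr R m) (eps u : R) (n : nat) : R :=
  let mu := meanK X p Q eps u in
  fine ('E_P[fun w => (Kfun p Q eps u (rvec X w) - mu) ^+ n]) / mu ^+ n.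

End Probability.

(* Main.v *)
Require Import Defs.
From HB Require Import structures.
From mathcomp Require Import all_boot all_order all_algebra.
From mathcomp Require Import all_classical all_reals all_analysis.
From mathcomp Require Import measurable_realfun lra.
From mathcomp Require mpoly.

Import Order.TTheory GRing.Theory Num.Theory.
Import numFieldNormedType.Exports.
Local Open Scope classical_set_scope.
Local Open Scope ring_scope.

(** Multiplying [u <= F] by [Q^2 > 0] and using the bound by [p] shows that,
    outside a null set, the event [u <= F] implies [0 <= K_u]. Since
    [mu < 0], the latter forces [- mu <= |K_u - mu|], and Markov's inequality
    for the even power [n] concludes. The event itself has to be measurable:
    the partial derivatives of the model are given by the forward-mode
    recursion [fp_tangent], which is measurable in the inputs. *)

(** * Derivatives of the floating-point model at zero errors *)

Definition aop_tangent (R : realType) (o : aop) (a b a' b' : R) : R :=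
  match o with
  | Add => a' + b'
  | Defs.Sub => a' - b'
  | Mul => a * b' + b * a'
  | Div => a * (- b ^- 2 * b') + b^-1 * a'
  end.

Arguments aop_tangent {R} o a b a' b'.

(** Derivative of the model in the direction [e]. At zero errors the operands have their exact
    values, and the factor [1 + e_i] contributes the value of the operation times its own
    coordinate. *)
Fixpoint fp_tangent (R : realType) (m : nat) (t : aexpr R m) (x : 'rV[R]_m) :
    'rV[R]_(nops t) -> R :=
  match t return 'rV[R]_(nops t) -> R with
  | Op o a b => fun e =>
      aop_tangent o (aeval a x) (aeval b x)
        (@fp_tangent R m a x (lsubmx (lsubmx e)))
        (@fp_tangent R m b x (rsubmx (lsubmx e)))
      + aop_eval o (aeval a x) (aeval b x) * rsubmx e 0 0
  | _ => fun _ => 0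
  end.

Arguments fp_tangent {R m} t x _.

(** A condition at a single point [x], weaker than [division_free], so that it also covers a
    quotient with a non-constant divisor. *)
Fixpoint divisors_neq0 (R : realType) (m : nat) (t : aexpr R m)
    (x : 'rV[R]_m) : bool :=
  match t with
  | Op o a b => [&& divisors_neq0 R m a x, divisors_neq0 R m b x &
                    if o is Div then aeval b x != 0 else true]
  | _ => true
  end.

Arguments divisors_neq0 {R m} t x.

Lemma is_derive_aop_eval (R : realType) (o : aop) (f g : R -> R) (df dg : R) :
  is_derive (0 : R) 1 f df -> is_derive (0 : R) 1 g dg ->
  (if o is Div then g 0 != 0 else true) ->
  is_derive (0 : R) 1 (fun h => aop_eval o (f h) (g h))
    (aop_tangent o (f 0) (g 0) df dg).
Proof.
move=> dfx dgx; case: o => /= g0.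
- exact: is_deriveD.
- exact: is_deriveB.
- exact: is_deriveM.
(* The quotient is differentiated as the product [a * b^-1]; hence the unsimplified [Div] branch of
   [aop_tangent]. *)
- have dV := is_deriveV g0 dgx.
  exact: (is_deriveM dfx dV).
Qed.

Section Expressions.
Variables (R : realType) (m : nat).
Implicit Types (t : aexpr R m) (x y : 'rV[R]_m).

Lemma constant_expr_aeval t x y : constant_expr t -> aeval t x = aeval t y.
Proof. by elim: t => //= o a iha b ihb /andP[/iha-> /ihb->]. Qed.

Lemma division_free_divisors_neq0 t x : division_free t -> divisors_neq0 t x.
Proof.
elim: t => //= o a iha b ihb /and3P[/iha-> /ihb->] /=.
by case: o => // /andP[cb]; rewrite (constant_expr_aeval b 0 x cb).
Qed.

(** On a line through the zero error vector only one-variable rules are needed. The induction is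
    over all directions, since each operand receives its own block of [v]. *)
Lemma is_derive_fpmodel_line t x (v : 'rV[R]_(nops t)) : divisors_neq0 t x ->
  is_derive (0 : R) 1 (fun h : R => fpmodel t x (h *: v) 0) (fp_tangent t x v).
Proof.
elim: t v => [j|c|o a iha b ihb] v /=; [by move=> _; exact: is_derive_cst..|].
case/and3P=> /(iha (lsubmx (lsubmx v))) da /(ihb (rsubmx (lsubmx v))) db o_ok.
pose A h := fpmodel a x (h *: lsubmx (lsubmx v)) 0.
pose B h := fpmodel b x (h *: rsubmx (lsubmx v)) 0.
pose c := rsubmx v 0 0.
have A0 : A 0 = aeval a x by rewrite /A scale0r fpmodel0.
have B0 : B 0 = aeval b x by rewrite /B scale0r fpmodel0.
rewrite (_ : (fun h => _) =
    (fun h => aop_eval o (A h) (B h)) * (fun h => 1 + h * c)); last first.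
  apply/funext => h; rewrite /A /B /c !linearZ /= !linear0.
  by rewrite !mxE addr0.
have dc : is_derive (0 : R) 1 (fun h : R => 1 + h * c) c.
  have -> : (fun h : R => 1 + h * c) = cst 1 + c \*: id.
    by apply/funext => h /=; rewrite mulrC.
  by apply: is_derive_eq; rewrite add0r scaler1.
have := is_derive_aop_eval R o A B _ _ da db; rewrite A0 B0 => /(_ o_ok) dop.
(* At [h = 0] the factor [1 + h * c] has value 1 and derivative [c], which gives the two summands of
   [fp_tangent]. *)
apply: is_derive_eq; rewrite A0 B0 mul0r addr0 scale1r addrC.
by congr (_ + _).
Qed.

Lemma dfp_deE t x i : divisors_neq0 t x ->
  dfp_de t x i = fp_tangent t x (delta_mx 0 i).
Proof.
move=> t0; have [_ <-] := is_derive_fpmodel_line t x (delta_mx 0 i) t0.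
(* The partial derivative and the derivative along the line are limits of the same difference
   quotient. *)
rewrite /dfp_de /derive.
set g := (X in X @ _); set h := (X in _ = lim (X @ _)).
suff -> : g = h by [].
by apply/funext => r; rewrite /g /h /= !addr0 scale0r /GRing.scale/= mulr1.
Qed.

End Expressions.

(** * Measurability of values, tangents and polynomials in the inputs *)

Section Measurability.
Variables (R : realType) (d : measure_display) (T : measurableType d).

(** Inversion is continuous away from 0, and on the singleton of 0 every function is measurable. *)
Lemma measurable_fun_invr (D : set R) : measurable_fun D (@GRing.inv R).
Proof.
apply: (@measurable_funS _ _ _ _ setT) => //.
rewrite -(setvU [set (0 : R)]).
apply/measurable_funU => //; first exact: measurableC.
split; last exact: measurable_fun_set1.
apply: subspace_continuous_measurable_fun; first exact: measurableC.
apply: continuous_in_subspaceT => r; rewrite inE /= => /eqP r0.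
exact: inv_continuous.
Qed.

Lemma measurable_aop_eval (o : aop) (f g : T -> R) :
  measurable_fun setT f -> measurable_fun setT g ->
  measurable_fun setT (fun w => aop_eval o (f w) (g w)).
Proof.
move=> mf mg; case: o => /=.
- exact: measurable_funD.
- exact: measurable_funB.
- exact: measurable_funM.
- apply: measurable_funM => //.
  by apply: (measurableT_comp (measurable_fun_invr setT) mg).
Qed.

Context {m : nat} {Y : T -> 'rV[R]_m}.
Hypothesis mY : forall j, measurable_fun setT (fun w => Y w 0 j).

Lemma measurable_aeval t : measurable_fun setT (fun w => aeval t (Y w)).
Proof. by elim: t => //= o a iha b ihb; exact: measurable_aop_eval. Qed.

Lemma measurable_fp_tangent t e :
  measurable_fun setT (fun w => fp_tangent t (Y w) e).
Proof.
elim: t e => //= o a iha b ihb e.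
have ma := measurable_aeval a; have mb := measurable_aeval b.
apply: measurable_funD; last first.
  by apply: measurable_funM => //; exact: measurable_aop_eval.
have mVb : measurable_fun setT (fun w => (aeval b (Y w))^-1).
  exact: (measurableT_comp (measurable_fun_invr setT) mb).
case: o => /=.
- exact: measurable_funD.
- exact: measurable_funB.
- by apply: measurable_funD; exact: measurable_funM.
- apply: measurable_funD; apply: measurable_funM => //.
  apply: measurable_funM => //; apply: measurable_funN.
  by under eq_fun do rewrite -exprVn; exact: measurable_funX.
Qed.

Lemma measurable_ppoly_eval p :
  measurable_fun setT (fun w => ppoly_eval p (Y w)).
Proof.
rewrite /ppoly_eval; under eq_fun do rewrite mpoly.mevalE.
apply: measurable_sum => k; apply: measurable_funM => //.
apply: measurable_prod => i _; apply: measurable_funX.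
(* The three blocks of variables are the inputs, their positive parts and their negative parts. *)
under eq_fun do rewrite mxE; case: splitP => j _; first exact: mY.
under eq_fun do rewrite mxE; case: splitP => l _;
  under eq_fun do rewrite mxE.
- exact: measurable_maxr.
- by apply: measurable_maxr => //; exact: measurable_funN.
Qed.

End Measurability.

(** * Boundedness, from which all the moments are finite *)

Section Boundedness.
Variables (R : realType) (T : Type).

Definition bounded_fun_on (f : T -> R) := exists M : R, forall w, `|f w| <= M.

Lemma bounded_fun_cst c : bounded_fun_on (fun=> c).
Proof. by exists `|c|. Qed.

Lemma bounded_funN f : bounded_fun_on f -> bounded_fun_on (fun w => - f w).
Proof. by move=> [M fM]; exists M => w; rewrite normrN. Qed.

Lemma bounded_funD f g : bounded_fun_on f -> bounded_fun_on g ->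
  bounded_fun_on (fun w => f w + g w).
Proof.
move=> [M fM] [K gK]; exists (M + K) => w.
by rewrite (le_trans (ler_normD _ _))// lerD.
Qed.

Lemma bounded_funM f g : bounded_fun_on f -> bounded_fun_on g ->
  bounded_fun_on (fun w => f w * g w).
Proof.
by move=> [M fM] [K gK]; exists (M * K) => w; rewrite normrM ler_pM.
Qed.

Lemma bounded_funX f n : bounded_fun_on f ->
  bounded_fun_on (fun w => f w ^+ n).
Proof.
move=> bf; elim: n => [|n ihn].
  by under eq_fun do rewrite expr0; exact: bounded_fun_cst.
by under eq_fun do rewrite exprS; exact: bounded_funM.
Qed.

Lemma bounded_fun_max0 f : bounded_fun_on f ->
  bounded_fun_on (fun w => Num.max (f w) 0).
Proof.
move=> [M fM]; exists M => w; apply: le_trans (fM w).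
by case: (leP (f w) 0); rewrite ?normr0.
Qed.

Lemma bounded_fun_sum (I : Type) (s : seq I) (f : I -> T -> R) :
  (forall i, bounded_fun_on (f i)) ->
  bounded_fun_on (fun w => \sum_(i <- s) f i w).
Proof.
move=> bf; elim: s => [|i s ihs].
  by under eq_fun do rewrite big_nil; exact: bounded_fun_cst.
by under eq_fun do rewrite big_cons; exact: bounded_funD.
Qed.

Lemma bounded_fun_prod (I : Type) (s : seq I) (f : I -> T -> R) :
  (forall i, bounded_fun_on (f i)) ->
  bounded_fun_on (fun w => \prod_(i <- s) f i w).
Proof.
move=> bf; elim: s => [|i s ihs].
  by under eq_fun do rewrite big_nil; exact: bounded_fun_cst.
by under eq_fun do rewrite big_cons; exact: bounded_funM.
Qed.

Context {m : nat} {Y : T -> 'rV[R]_m}.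
Hypothesis bY : forall j, bounded_fun_on (fun w => Y w 0 j).

(** Only division could destroy boundedness, and here the inverse of a divisor is a constant
    function. *)
Lemma bounded_aeval t : division_free t ->
  bounded_fun_on (fun w => aeval t (Y w)).
Proof.
elim: t => [j|c|o a iha b ihb] //=; first by move=> _; exact: bounded_fun_cst.
case/and3P => /iha ba /ihb bb; case: o => /=.
- by move=> _; exact: bounded_funD.
- by move=> _; apply: bounded_funD => //; exact: bounded_funN.
- by move=> _; exact: bounded_funM.
- case/andP=> cb _; apply: bounded_funM => //.
  under eq_fun do rewrite (constant_expr_aeval R m b _ 0 cb).
  exact: bounded_fun_cst.
Qed.

Lemma bounded_ppoly_eval p : bounded_fun_on (fun w => ppoly_eval p (Y w)).
Proof.
rewrite /ppoly_eval; under eq_fun do rewrite mpoly.mevalE.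
apply: bounded_fun_sum => k; apply: bounded_funM; first exact: bounded_fun_cst.
apply: bounded_fun_prod => i; apply: bounded_funX.
under eq_fun do rewrite mxE; case: splitP => j _; first exact: bY.
under eq_fun do rewrite mxE; case: splitP => l _;
  under eq_fun do rewrite mxE; apply: bounded_fun_max0; first exact: bY.
exact: bounded_funN.
Qed.

End Boundedness.

Arguments bounded_fun_on {R T} f.

(** * Markov's inequality for an even central moment *)

Section Probability.
Variables (d : measure_display) (T : measurableType d) (R : realType).
Variable P : probability T R.

Lemma bounded_expectation_fin_num (f : T -> R) : measurable_fun setT f ->
  bounded_fun_on f -> ('E_P[f])%E \is a fin_num.
Proof.
move=> mf [M fM]; rewrite unlock integrable_fin_num//.
apply: measurable_bounded_integrable => //.
  by rewrite -ge0_fin_numE// fin_num_measure.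
exists M; split; first exact: num_real.
by move=> K MK w _; exact: le_trans (fM w) (ltW MK).
Qed.

Lemma even_moment_tail (K : T -> R) (mu : R) (n : nat) :
  measurable_fun setT K -> bounded_fun_on K -> mu < 0 -> ~~ odd n ->
  (P [set w | (0 <= K w)%R] <=
    (fine ('E_P[fun w => ((K w - mu) ^+ n)%R])%E / mu ^+ n)%:E)%E.
Proof.
move=> mK bK mu0 n_even.
have mKmu : measurable_fun setT (fun w => K w - mu) by exact: measurable_funB.
(* Finiteness ensures that [fine] returns the true moment and not its default value 0. *)
have Efin : ('E_P[fun w => ((K w - mu) ^+ n)%R])%E \is a fin_num.
  apply: bounded_expectation_fin_num; first exact: measurable_funX.
  by apply: bounded_funX; apply: bounded_funD => //; exact: bounded_fun_cst.
have mun : 0 < mu ^+ n by rewrite exprn_even_gt0// (lt_eqF mu0) orbT.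
pose Z : {RV P >-> R} := mfun_Sub (mem_set mKmu).
have Nmu0 : 0 < - mu by rewrite oppr_gt0.
have := @markov _ _ _ P Z (fun r => r ^+ n) (- mu) Nmu0.
move=> /(_ (measurable_funX n (@measurable_id _ _ setT))).
move=> /(_ (fun r r0 => exprn_ge0 n r0)).
have -> : ((fun r : R => r ^+ n) \o (fun r : R => `|r|)) \o Z =
    (fun w => (K w - mu) ^+ n).
  by apply/funext => w /=; rewrite -normrX ger0_norm// exprn_even_ge0.
(* Evenness turns the Markov factor [(- mu) ^+ n] into the denominator [mu ^+ n]. *)
rewrite exprNn -signr_odd (negbTE n_even) mul1r => markovK.
have {markovK} /markovK :
    {in Num.nneg &, {homo (fun r : R => r ^+ n) : x y / x <= y}}.
  by move=> x y; rewrite !nnegrE => x0 y0; exact: lerXn2r.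
rewrite -[X in (_ <= X)%E](fineK Efin) EFinM => tail.
rewrite lee_pdivlMr// muleC; apply: le_trans tail.
rewrite lee_pmul2l ?lte_fin//; apply: le_measure; rewrite ?inE.
- rewrite -[X in measurable X]setTI -preimage_itvcy; exact: mK.
- rewrite -[X in measurable X]setTI.
  under [X in _ `&` X]eq_set do rewrite /= lee_fin.
  rewrite -(preimage_itvcy (fun w => `|Z w|)).
  exact: (measurableT_comp (@normr_measurable R setT) mKmu).
- move=> w /= K0; rewrite lee_fin.
  apply: le_trans (ler_norm _); rewrite /Z /=; lra.
Qed.

End Probability.

(** * From the error event to the event [0 <= K_u] *)

Theorem theorem4p6 (R : realType) (d : measure_display)
    (T : measurableType d) (P : probability T R)
    (m : nat) (I : 'I_m -> set R) (X : 'I_m -> {RV P >-> R})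
    (N Q : aexpr R m) (eps u : R) (p : ppoly R m) (n : nat)
    (f := Op Div N Q) :
  (forall j, is_interval (I j) /\ bounded_set (I j)) ->
  (forall j w, I j (X j w)) ->
  mutually_independent X ->
  0 < eps ->
  division_free N ->
  division_free Q ->
  (forall x : 'rV[R]_m, box I x -> aeval Q x != 0) ->
  (forall (x : 'rV[R]_m) (e : 'rV[R]_(nops f)),
      box I x -> (forall i, `|e 0 i| <= eps) ->
      \sum_(i < nops f) `|dfp_de f x i * aeval Q x ^+ 2 * e 0 i|
      <= ppoly_eval p x * eps) ->
  meanK X p Q eps u < 0 ->
  (2 <= n)%N ->
  ~~ odd n ->
  forall e : 'I_(nops f) -> {RV P >-> R},
    (forall i, {ae P, forall w, `|e i w| <= eps}) ->
    (P [set w | (u <= first_order_error f (rvec X w) (rvec e w))%R]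
     <= (flag X p Q eps u n)%:E)%E.
Proof.
move=> bI XI _ eps0 dfN dfQ Q0 p_bound mu0 _ n_even e e_eps.
pose Y := rvec X.
have boxY w : box I (Y w) by move=> j; rewrite mxE; exact: XI.
have mY j : measurable_fun setT (fun w => Y w 0 j).
  by under eq_fun do rewrite mxE; exact: measurable_funPT.
have bY j : bounded_fun_on (fun w => Y w 0 j).
  (* [bounded_set] provides a bound only for the reals strictly above [M], hence [M + 1]. *)
  have [_ [M [_ IM]]] := bI j; exists (M + 1) => w.
  by apply: IM; [rewrite ltrDl|exact: boxY].
have mK : measurable_fun setT (fun w => Kfun p Q eps u (Y w)).
  apply: measurable_funB; apply: measurable_funM => //.
    exact: measurable_ppoly_eval.
  by apply: measurable_funX; exact: measurable_aeval.
have bK : bounded_fun_on (fun w => Kfun p Q eps u (Y w)).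
  apply: bounded_funD; first apply: bounded_funM.
  - exact: bounded_ppoly_eval.
  - exact: bounded_fun_cst.
  - apply: bounded_funN; apply: bounded_funM; last exact: bounded_fun_cst.
    by apply: bounded_funX; exact: bounded_aeval.
have f_def w : divisors_neq0 f (Y w).
  by rewrite /= !division_free_divisors_neq0//= Q0.
have mF : measurable_fun setT (fun w => first_order_error f (Y w) (rvec e w)).
  apply: measurable_sum => i.
  apply: (measurableT_comp (@normr_measurable R setT)).
  apply: measurable_funM; last first.
    by under eq_fun do rewrite mxE; exact: measurable_funPT.
  under eq_fun do rewrite dfp_deE//.
  exact: measurable_fp_tangent.
(* The finitely many almost sure bounds on the errors hold simultaneously outside one measurable
   null set [B]. *)
have [B [mB PB0 e_big]] :
    P.-negligible (~` [set w | forall i, `|e i w| <= eps]).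
  by have := filter_forall (ae_filter_ringOfSetsType P) e_eps.
have mK0 : measurable [set w | 0 <= Kfun p Q eps u (Y w)].
  rewrite -[X in measurable X]setTI -preimage_itvcy; exact: mK.
apply: le_trans (even_moment_tail _ _ _ P _ _ n mK bK mu0 n_even).
(* Adding [B] to the event [0 <= K_u] keeps its probability and makes the inclusion hold at every
   sample point. *)
rewrite -(measureU0 mK0 mB PB0); apply: le_measure; rewrite ?inE.
- rewrite -[X in measurable X]setTI -preimage_itvcy; exact: mF.
- exact: measurableU.
move=> w /= uF.
have [/e_big|/contrapT e_small] := pselect (~ forall i, `|e i w| <= eps).
  by right.
left; rewrite /Kfun subr_ge0.
have e_le i : `|rvec e w 0 i| <= eps by rewrite mxE.
apply: le_trans (p_bound _ _ (boxY w) e_le).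
(* The square of [Q] is nonnegative, so it leaves the absolute values and multiplies the whole
   first-order error, which is at least [u] here. *)
have -> : \sum_i `|dfp_de f (Y w) i * aeval Q (Y w) ^+ 2 * rvec e w 0 i| =
    aeval Q (Y w) ^+ 2 * first_order_error f (Y w) (rvec e w).
  rewrite /first_order_error mulr_sumr; apply: eq_bigr => i _.
  by rewrite mulrAC normrM [RHS]mulrC [`|_ ^+ 2|]ger0_norm// sqr_ge0.
by rewrite ler_wpM2l// sqr_ge0.
Qed.
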